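(* Let $\alpha_0+\alpha_1+\alpha_2+\alpha_3+\alpha_4=\frac12$ and consider the system \begin{align*} \frac{dx}{dt}&=\frac{2x^2y}{t}-x^2-\frac{2(\alpha_2+\alpha_3+\alpha_4)x}{t}+\frac1t+\frac{2z(zw+\alpha_3)}{t},\\ \frac{dy}{dt}&=-\frac{2xy^2}{t}+2xy+\frac{2(\alpha_2+\alpha_3+\alpha_4)y}{t}+\alpha_1,\\ \frac{dz}{dt}&=\frac{2z^2w}{t}-z^2-\frac{2\alpha_4z}{t}+\frac1t+\frac{2yz^2}{t},\\ \frac{dw}{dt}&=-\frac{2zw^2}{t}+2zw+\frac{2\alpha_4w}{t}+\alpha_3-\frac{2y(2zw+\alpha_3)}{t}. \end{align*} Make the change of parameters and variables $$\beta_0=\alpha_3+2\alpha_4,\quad\beta_1=\alpha_3,\quad\beta_2=\alpha_2,\quad\beta_3=\alpha_1,\quad\beta_4=\alpha_0,$$ $$X=\frac1z,\quad Y=-z(zw+\alpha_3),\quad Z=\frac1x,\quad W=-x(xy+\alpha_1),\quad T=t.$$ Then the system can be written in the new variables $T,X,Y,Z,W$ and parameters $\beta_0,\dots,\beta_4$ as a Hamiltonian system, and this new system coincides with the system of type $B_4^{(1)}$: \begin{align*} \frac{dX}{dT}&=\frac{2X^2Y-X^2+(\beta_0+\beta_1)X+2\beta_3Z+2Z^2W}{T}+1,\\ \frac{dY}{dT}&=\frac{-2XY^2+2XY-(\beta_0+\beta_1)Y+\beta_1}{T},\\ \frac{dZ}{dT}&=\frac{2Z^2W-Z^2+(1-2\beta_4)Z+2YZ^2}{T}+1,\\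 \frac{dW}{dT}&=\frac{-2ZW^2+2ZW-(1-2\beta_4)W-2\beta_3Y-4YZW+\beta_3}{T}, \end{align*} with the Hamiltonian $$H=\frac{X^2Y(Y-1)+X\{(\beta_0+\beta_1)Y-\beta_1\}+TY}{T}+\frac{Z^2W(W-1)+Z\{(1-2\beta_4)W-\beta_3\}+TW}{T}+\frac{2YZ(ZW+\beta_3)}{T}.$$
   Context: A Hamiltonian system with Hamiltonian $H(X,Y,Z,W,T)$ means $dX/dT=\partial H/\partial Y$, $dY/dT=-\partial H/\partial X$, $dZ/dT=\partial H/\partial W$, $dW/dT=-\partial H/\partial Z$. *)

(* Defs.v *)
From mathcomp Require Import all_boot all_order all_algebra.
From mathcomp Require Import all_classical all_reals all_analysis.
Set Implicit Arguments.
Unset Strict Implicit.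
Unset Printing Implicit Defensive.
Import Order.TTheory GRing.Theory Num.Theory.
Import numFieldNormedType.Exports.
Local Open Scope classical_set_scope.
Local Open Scope ring_scope.

(* K is the field of scalars; the real numbers and the complex numbers are
   instances of numFieldType.  In both cases is_derive t 1 f l says that the
   difference quotient of f at t tends to l in K, so that over the complex
   numbers derivatives are holomorphic ones. *)

Record params (K : Type) := Params { p0 : K; p1 : K; p2 : K; p3 : K; p4 : K }.

(* (q1, r1) and (q2, r2) are the two conjugate pairs: (x, y) and (z, w) for the
   original system, (X, Y) and (Z, W) for the transformed one. *)
Record phase (K : Type) := Phase { q1 : K; r1 : K; q2 : K; r2 : K }.

(* The right-hand side of a nonautonomous system of four first-order ODEs. *)
Definition ode_system (K : Type) := K -> phase K -> phase K.

Definition solves_on (K : numFieldType) (D : set K) (F : ode_system K)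
    (c : K -> phase K) : Prop :=
  forall t, D t ->
    [/\ is_derive t 1 (fun s => q1 (c s)) (q1 (F t (c t))),
        is_derive t 1 (fun s => r1 (c s)) (r1 (F t (c t))),
        is_derive t 1 (fun s => q2 (c s)) (q2 (F t (c t))) &
        is_derive t 1 (fun s => r2 (c s)) (r2 (F t (c t)))].

(* On the times in D, the partial derivatives of H(X, Y, Z, W, T) exist and F is
   X' = dH/dY, Y' = - dH/dX, Z' = dH/dW, W' = - dH/dZ. *)
Definition hamiltonian_system (K : numFieldType) (D : set K)
    (H : K -> K -> K -> K -> K -> K) (F : ode_system K) : Prop :=
  forall T X Y Z W, D T ->
    let V := F T (Phase X Y Z W) in
    [/\ is_derive Y 1 (fun Y' => H X Y' Z W T) (q1 V),
        is_derive X 1 (fun X' => H X' Y Z W T) (- r1 V),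
        is_derive W 1 (fun W' => H X Y Z W' T) (q2 V) &
        is_derive Z 1 (fun Z' => H X Y Z' W T) (- r2 V)].

Definition original_system (K : numFieldType) (a : params K) : ode_system K :=
  fun t u =>
    let: Params a0 a1 a2 a3 a4 := a in
    let: Phase x y z w := u in
    Phase
      (2 * x ^+ 2 * y / t - x ^+ 2 - 2 * (a2 + a3 + a4) * x / t + 1 / t
         + 2 * z * (z * w + a3) / t)
      (- (2 * x * y ^+ 2 / t) + 2 * x * y + 2 * (a2 + a3 + a4) * y / t + a1)
      (2 * z ^+ 2 * w / t - z ^+ 2 - 2 * a4 * z / t + 1 / t
         + 2 * y * z ^+ 2 / t)
      (- (2 * z * w ^+ 2 / t) + 2 * z * w + 2 * a4 * w / t + a3
         - 2 * y * (2 * z * w + a3) / t).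

Definition B4_system (K : numFieldType) (b : params K) : ode_system K :=
  fun T U =>
    let: Params b0 b1 b2 b3 b4 := b in
    let: Phase X Y Z W := U in
    Phase
      ((2 * X ^+ 2 * Y - X ^+ 2 + (b0 + b1) * X + 2 * b3 * Z
          + 2 * Z ^+ 2 * W) / T + 1)
      ((- (2 * X * Y ^+ 2) + 2 * X * Y - (b0 + b1) * Y + b1) / T)
      ((2 * Z ^+ 2 * W - Z ^+ 2 + (1 - 2 * b4) * Z + 2 * Y * Z ^+ 2) / T + 1)
      ((- (2 * Z * W ^+ 2) + 2 * Z * W - (1 - 2 * b4) * W - 2 * b3 * Y
          - 4 * Y * Z * W + b3) / T).

Definition B4_hamiltonian (K : numFieldType) (b : params K)
    (X Y Z W T : K) : K :=
  let: Params b0 b1 b2 b3 b4 := b in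
  (X ^+ 2 * Y * (Y - 1) + X * ((b0 + b1) * Y - b1) + T * Y) / T
  + (Z ^+ 2 * W * (W - 1) + Z * ((1 - 2 * b4) * W - b3) + T * W) / T
  + 2 * Y * Z * (Z * W + b3) / T.

Definition change_params (K : numFieldType) (a : params K) : params K :=
  let: Params a0 a1 a2 a3 a4 := a in Params (a3 + 2 * a4) a3 a2 a1 a0.

(* The independent variable is unchanged (T = t). *)
Definition change_vars (K : numFieldType) (a : params K) (u : phase K) :
    phase K :=
  let: Params a0 a1 a2 a3 a4 := a in
  let: Phase x y z w := u in
  Phase (1 / z) (- z * (z * w + a3)) (1 / x) (- x * (x * y + a1)).

(* The set where change_vars is defined, and also its image: 1 / 0 is 0. *)
Definition chart (K : numFieldType) : set (phase K) :=
  [set u | q1 u != 0 /\ q2 u != 0].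
Arguments chart : clear implicits.

(* Main.v *)
Require Import Defs.
From mathcomp Require Import all_boot all_order all_algebra.
From mathcomp Require Import all_classical all_reals all_analysis.
From mathcomp Require Import ring.
Set Implicit Arguments.
Unset Strict Implicit.
Unset Printing Implicit Defensive.
Import Order.TTheory GRing.Theory Num.Theory.
Import numFieldNormedType.Exports.
Local Open Scope classical_set_scope.
Local Open Scope ring_scope.

(** For each constant k the map (p, r) |-> (1/p, - p (p r + k)) is an involution
of {p != 0}.  The change of variables applies it to both conjugate pairs and
exchanges them, so its inverse is the change of variables with alpha_1 and
alpha_3 exchanged.  Hence both directions of the equivalence reduce to the
chain rule and a rational identity between a vector field and the pushforward
of the other one; openness of the time domain lets one recover the derivatives
of the original curve from those of its image under both changes. *)

Lemma is_derive_recip (K : numFieldType) (V : normedModType K) (f : V -> K)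
    (x v : V) (df : K) :
  f x != 0 -> is_derive x v f df ->
  is_derive x v (fun y => 1 / f y) (- df / f x ^+ 2).
Proof.
move=> fx0 [dv dvE].
have -> : (fun y => 1 / f y) = (fun y => (f y)^-1).
  by apply/funext => y; rewrite div1r.
apply: DeriveDef; first exact: derivableV.
by rewrite deriveV// dvE /GRing.scale/= mulNr mulrC mulNr.
Qed.

Lemma is_derive_conjugate (K : numFieldType) (V : normedModType K)
    (f g : V -> K) (x v : V) (df dg k : K) :
  is_derive x v f df -> is_derive x v g dg ->
  is_derive x v (fun y => - f y * (f y * g y + k))
    (- df * (2 * f x * g x + k) - f x ^+ 2 * dg).
Proof.
move=> Df Dg.
have -> : (fun y => - f y * (f y * g y + k)) = - f * (f * g + cst k) by [].
apply: is_derive_eq; rewrite /GRing.scale/= !fctE /cst; ring.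
Qed.

(** The Hamiltonian has degree at most two in each of X, Y, Z, W separately, so each partial
    derivative is settled by two coefficients. Writing the constant term as [f 0] avoids supplying a
    third. *)
Lemma is_derive_quadratic (K : numFieldType) (f : K -> K) (A B x l : K) :
  (forall s, f s = A * s ^+ 2 + B * s + f 0) -> 2 * A * x + B = l ->
  is_derive x 1 f l.
Proof.
move=> fE <-.
have -> : f = cst A * (id : K -> K) ^+ 2 + cst B * id + cst (f 0).
  by apply/funext => s; rewrite fE.
apply: is_derive_eq; rewrite /GRing.scale/= /cst; ring.
Qed.

(** The differential of [change_vars a] at [u], applied to the tangent vector [v]. *)
Definition pushforward (K : numFieldType) (a : params K) (u v : phase K) :
    phase K :=
  Phase (- q2 v / q2 u ^+ 2)
    (- q2 v * (2 * q2 u * r2 u + p3 a) - q2 u ^+ 2 * r2 v)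
    (- q1 v / q1 u ^+ 2)
    (- q1 v * (2 * q1 u * r1 u + p1 a) - q1 u ^+ 2 * r1 v).

Lemma solves_on_change_vars (K : numFieldType) (a : params K) (D : set K)
    (F G : ode_system K) (c : K -> phase K) :
  (forall t, D t -> chart K (c t)) ->
  (forall t u, D t -> chart K u ->
     pushforward a u (F t u) = G t (change_vars a u)) ->
  solves_on D F c -> solves_on D G (fun t => change_vars a (c t)).
Proof.
move=> cD FG solc t Dt; have [d1 d2 d3 d4] := solc t Dt.
have [c1 c2] := cD t Dt.
rewrite -(FG _ _ Dt (cD t Dt)).
(* Stated with projections, since [c s] under the binder is not a constructor and [change_vars]
   cannot reduce there. *)
have cvE u : change_vars a u = Phase (1 / q2 u)
    (- q2 u * (q2 u * r2 u + p3 a)) (1 / q1 u)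
    (- q1 u * (q1 u * r1 u + p1 a)) by case: a u {FG} => ? ? ? ? ? [].
split=> /=; under eq_fun do rewrite cvE /=.
- exact: is_derive_recip.
- exact: is_derive_conjugate.
- exact: is_derive_recip.
- exact: is_derive_conjugate.
Qed.

(** Each constant stays attached to its conjugate pair, so exchanging the pairs exchanges the
    constants. *)
Definition swap13 (K : Type) (a : params K) : params K :=
  Params (p0 a) (p3 a) (p2 a) (p1 a) (p4 a).

Lemma chart_change_vars (K : numFieldType) (a : params K) (u : phase K) :
  chart K u -> chart K (change_vars a u).
Proof.
case: a u => a0 a1 a2 a3 a4 [x y z w] [/= x0 z0].
by split; rewrite /= div1r invr_neq0.
Qed.

(** On one pair, P = 1/p and R = - p (p r + k) give P R + k = - p r, hence - P (P R + k) = r. *)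
Lemma change_varsK (K : numFieldType) (a : params K) (u : phase K) :
  chart K u -> change_vars (swap13 a) (change_vars a u) = u.
Proof.
case: a u => a0 a1 a2 a3 a4 [x y z w] [/= x0 z0].
by congr Phase; field; rewrite ?x0 ?z0.
Qed.

Lemma swap13K (K : Type) : involutive (@swap13 K).
Proof. by case. Qed.

Lemma set_bij_change_vars (K : numFieldType) (a : params K) :
  set_bij (chart K) (chart K) (change_vars a).
Proof.
split=> [u|u v|u] /=.
- exact: chart_change_vars.
- rewrite !inE => uK vK uv.
  by rewrite -(change_varsK a uK) uv change_varsK.
- move=> uK; exists (change_vars (swap13 a) u); first exact: chart_change_vars.
  by rewrite -{1}(swap13K a) change_varsK.
Qed.

(** A derivative depends on the curve near [t]; as [D] is open, agreement on [D] is agreement near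
    each of its points. *)
Lemma solves_on_eq (K : numFieldType) (D : set K) (F : ode_system K)
    (c d : K -> phase K) :
  open D -> {in D, c =1 d} -> solves_on D F c -> solves_on D F d.
Proof.
move=> oD cd solc t Dt; have := solc t Dt.
rewrite (cd t (mem_set Dt)) => -[d1 d2 d3 d4].
have near_cd (p : phase K -> K) : \near t, p (c t) = p (d t).
  have := open_nbhs_nbhs (conj oD Dt).
  by apply: filterS => s Ds; rewrite cd// inE.
by split; apply: near_eq_is_derive (near_cd _) _.
Qed.

(** Turns the coefficient 1 - 2 beta_4 of the new system into the parameters that occur in the
    original one. *)
Lemma params_sum_p0 (K : numFieldType) (a : params K) :
  p0 a + p1 a + p2 a + p3 a + p4 a = 1 / 2 ->
  1 - 2 * p0 a = 2 * (p1 a + p2 a + p3 a + p4 a).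
Proof.
move=> ha; have -> : p0 a = 1 / 2 - (p1 a + p2 a + p3 a + p4 a).
  by rewrite -ha; ring.
by field.
Qed.

Lemma pushforward_original_system (K : numFieldType) (a : params K)
    (t : K) (u : phase K) :
  p0 a + p1 a + p2 a + p3 a + p4 a = 1 / 2 -> t != 0 -> chart K u ->
  pushforward a u (original_system a t u) =
  B4_system (change_params a) t (change_vars a u).
Proof.
move=> /params_sum_p0.
case: a u => a0 a1 a2 a3 a4 [x y z w] /= ha t0 [/= x0 z0].
by rewrite /pushforward /= ha; congr Phase; field; rewrite ?t0 ?x0 ?z0.
Qed.

Lemma pushforward_B4_system (K : numFieldType) (a : params K)
    (t : K) (u : phase K) :
  p0 a + p1 a + p2 a + p3 a + p4 a = 1 / 2 -> t != 0 -> chart K u ->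
  pushforward (swap13 a) u (B4_system (change_params a) t u) =
  original_system a t (change_vars (swap13 a) u).
Proof.
move=> /params_sum_p0.
case: a u => a0 a1 a2 a3 a4 [x y z w] /= ha t0 [/= x0 z0].
by rewrite /pushforward /= ha; congr Phase; field; rewrite ?t0 ?x0 ?z0.
Qed.

Lemma hamiltonian_B4_system (K : numFieldType) (b : params K) :
  hamiltonian_system [set T : K | T != 0] (B4_hamiltonian b) (B4_system b).
Proof.
case: b => b0 b1 b2 b3 b4 T X Y Z W /= T0; split.
(* In each case, the coefficients in H of the square and of the first power of the varied
   variable. *)
- apply: (@is_derive_quadratic _ _ (X ^+ 2 / T)
    ((- X ^+ 2 + (b0 + b1) * X + T + 2 * Z * (Z * W + b3)) / T)) => [s|] /=;
    by field.
- apply: (@is_derive_quadratic _ _ (Y * (Y - 1) / T)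
    (((b0 + b1) * Y - b1) / T)) => [s|] /=; by field.
- apply: (@is_derive_quadratic _ _ (Z ^+ 2 / T)
    ((- Z ^+ 2 + (1 - 2 * b4) * Z + T + 2 * Y * Z ^+ 2) / T)) => [s|] /=;
    by field.
- apply: (@is_derive_quadratic _ _ ((W * (W - 1) + 2 * Y * W) / T)
    (((1 - 2 * b4) * W - b3 + 2 * Y * b3) / T)) => [s|] /=; by field.
Qed.

Theorem theorem6p5 (K : numFieldType) (a : params K)
    (ha : p0 a + p1 a + p2 a + p3 a + p4 a = 1 / 2) :
  [/\ set_bij (chart K) (chart K) (change_vars a),
      forall (D : set K) (c : K -> phase K),
        open D -> (forall t, D t -> t != 0) ->
        (forall t, D t -> chart K (c t)) ->
        (solves_on D (original_system a) c <->
         solves_on D (B4_system (change_params a))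
           (fun t => change_vars a (c t))) &
      hamiltonian_system [set T : K | T != 0]
        (B4_hamiltonian (change_params a)) (B4_system (change_params a))].
Proof.
split; [exact: set_bij_change_vars| |exact: hamiltonian_B4_system].
move=> D c oD D0 cD; split.
  apply: solves_on_change_vars => // t u Dt uK.
  exact: pushforward_original_system (D0 t Dt) uK.
move=> solB.
(* The twice transformed curve is known to equal [c] only on [D], where [c] stays in the chart. *)
apply: (@solves_on_eq _ _ _
  (fun t => change_vars (swap13 a) (change_vars a (c t)))) => //.
  by move=> t; rewrite inE => Dt; rewrite change_varsK//; exact: cD.
apply: solves_on_change_vars solB => [t Dt|t u Dt uK].
  by apply: chart_change_vars; exact: cD.
exact: pushforward_B4_system (D0 t Dt) uK.
Qed.
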